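(* There is a constant $c>0$ such that for every integer $n\ge 1$, with $N=2^n$, the $2N\times 2N$ unitary matrix $C_N^{\mathrm{II}}\oplus (-i)\,S_N^{\mathrm{II}}$ can be realized exactly by a quantum circuit on $n+1$ qubits (plus at most a constant number of ancilla qubits that start and end in $|0\rangle$) consisting of at most $c\,n^2$ elementary gates. In short, $C_N^{\mathrm{II}}$ and $S_N^{\mathrm{II}}$ (and hence their transposes $C_N^{\mathrm{III}}$, $S_N^{\mathrm{III}}$) can be realized with $O(\log^2 N)$ elementary quantum gates.
   Context: Qubit/basis conventions: the state space of $m$ qubits is $\mathbb{C}^{2^m}$ with computational basis $|x\rangle$, $x$ a bit string $b_m\dots b_1$ identified with the integer $\sum_k b_k2^{k-1}$; the most significant bit corresponds to the leftmost tensor factor. Elementary gates: (i) a CNOT between any two qubits, and (ii) any single-qubit gate $I_{2^{m-t}}\otimes U\otimes I_{2^{t-1}}$ with $U\in\mathcal U(2)$ arbitrary. A circuit realizes a unitary $W$ if the product of its gates equals $W$ (ancillas, if any, mapped $|0\rangle\mapsto|0\rangle$). $A\oplus B$ is the block-diagonal matrix with blocks $A,B$. Type II transforms: $C_N^{\mathrm{II}}=\sqrt{2/N}\,[k_j\cos(j(l+\tfrac12)\pi/N)]_{j,l=0,\dots,N-1}$ with $k_0=1/\sqrt2$, $k_j=1$ for $j\ge1$; $S_N^{\mathrm{II}}=\sqrt{2/N}\,[k'_j\sin(j(l+\tfrac12)\pi/N)]_{j=1,\dots,N;\ l=0,\dots,N-1}$ with $k'_N=1/\sqrt2$, $k'_j=1$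 for $j<N$. $C_N^{\mathrm{III}}$, $S_N^{\mathrm{III}}$ are the transposes of $C_N^{\mathrm{II}}$, $S_N^{\mathrm{II}}$. $i=\sqrt{-1}$. *)

(* Defs.v *)
(* matrices over complex numbers (real_closed's complex)
   built on Stdlib's reals R, which is a realType via Rstruct. *)
From HB Require Import structures.
From mathcomp Require Import all_boot all_order all_algebra.
From mathcomp Require Import complex.
From mathcomp Require Import all_classical all_reals.
From mathcomp Require Import Rstruct trigo.
From Stdlib Require Rdefinitions.
Set Implicit Arguments. Unset Strict Implicit. Unset Printing Implicit Defensive.
Import Order.TTheory GRing.Theory Num.Theory.
Local Open Scope ring_scope.

(* The complex numbers. *)
Definition Cx := complex Rdefinitions.R.

(* Conjugate transpose and unitarity. *)
Definition adj_mx (m : nat) (A : 'M[Cx]_m) : 'M[Cx]_m :=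
  (map_mx (fun z : Cx => z^*) A)^T.
Definition unitary_mx (m : nat) (A : 'M[Cx]_m) : Prop :=
  A *m adj_mx A = 1%:M.

(* Bit k (0-indexed from the least significant bit) of x, i.e. bit b_{k+1}. *)
Definition bitn (k x : nat) : bool := odd (x %/ 2 ^ k).
(* x with bit k cleared. *)
Definition clrbit (k x : nat) : nat := subn x (bitn k x * 2 ^ k)%N.
(* x with bit k toggled. *)
Definition flipbit (k x : nat) : nat :=
  if bitn k x then subn x (2 ^ k)%N else (x + 2 ^ k)%N.

(* Elementary gates on m qubits; qubit positions are 'I_m with position k
   being the qubit of bit b_{k+1} (k = t-1 in the paper's notation). *)
Inductive gate (m : nat) : Type :=
  | Single of 'I_m & 'M[Cx]_2      (* single-qubit gate U on qubit k *)
  | CNOT of 'I_m & 'I_m.           (* CNOT with (control, target)     *)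

Definition gate_ok (m : nat) (g : gate m) : Prop :=
  match g with
  | Single _ U => unitary_mx U
  | CNOT a b => a != b
  end.

Definition bit_ord (k x : nat) : 'I_2 := inord (bitn k x).

(* Matrix of a gate, acting on column vectors in the computational basis
   |x>, x in [0, 2^m).  Single k U = I_{2^(m-1-k)} (x) U (x) I_{2^k};
   CNOT a b maps |x> to |x> if bit a of x is 0 and to |x with bit b
   flipped> otherwise. *)
Definition gate_mx (m : nat) (g : gate m) : 'M[Cx]_(2 ^ m) :=
  match g with
  | Single k U => \matrix_(x, y)
      (if clrbit k x == clrbit k y then U (bit_ord k x) (bit_ord k y) else 0)
  | CNOT a b => \matrix_(x, y)
      ((x : nat) == (if bitn a y then flipbit b y else y))%:R
  end.

(* Product of the gates of a circuit (in list order). *)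
Definition circuit_mx (m : nat) (gs : seq (gate m)) : 'M[Cx]_(2 ^ m) :=
  \prod_(g <- gs) gate_mx g.

(* A circuit on (p + a) qubits realizes W on the p low qubits, with a
   ancillas (the a most significant qubits) mapped |0> to |0>:
   G (|j> (x) |0...0>) = (W |j>) (x) |0...0>  for every basis state |j>. *)
Definition realizes_with_ancillas (p a : nat) (gs : seq (gate (p + a)))
    (W : 'M[Cx]_(2 ^ p)) : Prop :=
  forall (y : 'I_(2 ^ (p + a))) (j : 'I_(2 ^ p)), (y : nat) = j ->
    (forall (x : 'I_(2 ^ (p + a))) (i : 'I_(2 ^ p)), (x : nat) = i ->
       circuit_mx gs x y = W i j) /\
    (forall x : 'I_(2 ^ (p + a)), (2 ^ p <= x)%N -> circuit_mx gs x y = 0).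

(* Type II DCT and DST. *)
Definition kC (N j : nat) : Rdefinitions.R :=
  if j == 0%N then (Num.sqrt 2)^-1 else 1.
Definition kS (N j : nat) : Rdefinitions.R :=
  if j == N then (Num.sqrt 2)^-1 else 1.

(* Real entries of C_N^II (row j, column l, both in 0..N-1) and of
   S_N^II (row j in 1..N, column l in 0..N-1). *)
Definition cII_entry (N j l : nat) : Rdefinitions.R :=
  Num.sqrt (2 / N%:R) * kC N j * cos (j%:R * (l%:R + 2^-1) * pi / N%:R).
Definition sII_entry (N j l : nat) : Rdefinitions.R :=
  Num.sqrt (2 / N%:R) * kS N j * sin (j%:R * (l%:R + 2^-1) * pi / N%:R).

Definition CII (N : nat) : 'M[Cx]_N :=
  \matrix_(j, l) (cII_entry N j l)%:C%C.
(* row index r : 'I_N corresponds to j = r + 1 in 1..N *)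
Definition SII (N : nat) : 'M[Cx]_N :=
  \matrix_(r, l) (sII_entry N r.+1 l)%:C%C.

Lemma two_pow_double (n : nat) : (2 ^ n + 2 ^ n = 2 ^ n.+1)%N.
Proof. by rewrite expnS mul2n addnn. Qed.

(* C_N^II (+) (-i) S_N^II for N = 2^n, as a 2^(n+1) x 2^(n+1) matrix. *)
Definition DCT_DST_block (n : nat) : 'M[Cx]_(2 ^ n.+1) :=
  castmx (two_pow_double n, two_pow_double n)
    (block_mx (CII (2 ^ n)) 0 0 ((- 'i%C) *: SII (2 ^ n))).

(* Main.v *)
Require Import Defs.
From HB Require Import structures.
From mathcomp Require Import all_boot all_order all_algebra.
From mathcomp Require Import complex.
From mathcomp Require Import all_classical all_reals.
From mathcomp Require Import Rstruct trigo.
From mathcomp Require Import ring lra zify.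

(** Let [N = 2^n].  Mapping [|0,x>] and [|1,x>] to [(|0,x> + |1,~x>) / sqrt 2] and
    [(|0,x> - |1,~x>) / sqrt 2], where [~] complements every bit, followed by the
    Fourier transform of size [2N] and the phases [exp (i pi j / 2N)], yields the
    rows [cos (j (l + 1/2) pi / N)] and [i sin (j (l + 1/2) pi / N)], scaled by
    [1 / sqrt N].  Rows [j] and [2N - j] agree up to sign, so the transform is
    obtained by negating the low bits when the top bit is set (which pairs [j] with
    [2N - j]), mixing the top bit, and shifting the sine rows by one.  The mixing
    must be switched off when the low bits vanish; this test comes from the carry
    of an increment, and increments are diagonal in the Fourier basis, so that
    everything reduces to Fourier transforms and no ancilla is needed. *)

Set Implicit Arguments. Unset Strict Implicit. Unset Printing Implicit Defensive.
Import Order.TTheory GRing.Theory Num.Theory.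

(** * Bit strings *)

Definition bits := nat -> bool.

Definition upd (b : bits) (k : nat) (c : bool) : bits :=
  fun i => if i == k then c else b i.

Fixpoint bval (q : nat) (b : bits) : nat :=
  if q is q'.+1 then bval q' b + b q' * 2 ^ q' else 0.

(** Only [x] modulo [2 ^ q] matters, so register arithmetic wraps around without explicit
    reductions. *)
Definition setlow (q x : nat) (b : bits) : bits :=
  fun i => if i < q then bitn i x else b i.

Lemma bval_lt q b : bval q b < 2 ^ q.
Proof.
elim: q => [//|q IH] /=; rewrite expnS.
by case: (b q); lia.
Qed.

Lemma eq_bval q b b' : (forall i, i < q -> b i = b' i) -> bval q b = bval q b'.
Proof.
elim: q => [//|q IH] H /=; rewrite IH ?H // => i Hi; apply: H; lia.
Qed.

Lemma bitn_bval q b k : k < q -> bitn k (bval q b) = b k.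
Proof.
elim: q => [//|q IH] /=; rewrite ltnS leq_eqVlt => /orP[/eqP->|kq].
  rewrite /bitn addnC divnMDl ?expn_gt0 // divn_small ?bval_lt // addn0.
  by case: (b q).
(* Bit [q] contributes an even multiple of [2 ^ k], which leaves the parity of the quotient
   unchanged. *)
have E : 2 ^ q = 2 ^ (q - k) * 2 ^ k by rewrite -expnD subnK // ltnW.
rewrite -[RHS]IH // /bitn addnC E mulnA.
rewrite divnMDl ?expn_gt0 // oddD oddM oddX.
by rewrite -[_ == 0]leqn0 leqNgt subn_gt0 kq andbF.
Qed.

Lemma bval_inj q b b' : bval q b = bval q b' -> forall i, i < q -> b i = b' i.
Proof. by move=> E i Hi; rewrite -(bitn_bval b Hi) E bitn_bval. Qed.

Lemma bval_bitn q x : bval q (bitn^~ x) = x %% 2 ^ q.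
Proof.
elim: q => [|q IH] /=; first by rewrite modn1.
rewrite IH /bitn -modn2 expnSr; move: (2 ^ q) (expn_gt0 2 q) => d d0.
have lt : x %% d + x %/ d %% 2 * d < d * 2.
  by have := ltn_pmod x d0; have := ltn_pmod (x %/ d) (isT : 0 < 2); nia.
rewrite [in RHS](divn_eq x d) {2}(divn_eq (x %/ d) 2) mulnDl -addnA -mulnA.
by rewrite (mulnC 2) modnMDl [in RHS]addnC [RHS]modn_small.
Qed.

Lemma bitn_mod q x k : k < q -> bitn k (x %% 2 ^ q) = bitn k x.
Proof. by move=> kq; rewrite -bval_bitn bitn_bval. Qed.

Lemma bval_setlow q x b : bval q (setlow q x b) = x %% 2 ^ q.
Proof. by rewrite -bval_bitn; apply: eq_bval => i Hi; rewrite /setlow Hi. Qed.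

Lemma setlow_bval q b : setlow q (bval q b) b = b.
Proof. by apply/funext => i; rewrite /setlow; case: ltnP => // /bitn_bval->. Qed.

Lemma setlowK q x y b : setlow q x (setlow q y b) = setlow q x b.
Proof. by apply/funext => i; rewrite /setlow; case: ltnP. Qed.

Lemma setlow_mod q x b : setlow q (x %% 2 ^ q) b = setlow q x b.
Proof. by apply/funext => i; rewrite /setlow; case: ltnP => // /bitn_mod->. Qed.

Lemma bval_upd q b k c : q <= k -> bval q (upd b k c) = bval q b.
Proof.
by move=> qk; apply: eq_bval => i iq; rewrite /upd; case: eqP => // E; lia.
Qed.

(** * Circuits as operators on amplitude functions *)

Local Open Scope ring_scope.

(* Amplitudes are indexed by infinite bit strings, so that operators do not
   mention the number of qubits. *)
Definition state := bits -> Cx.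

Definition single (k : nat) (f : bool -> bool -> Cx) (v : state) : state :=
  fun b => f (b k) false * v (upd b k false) + f (b k) true * v (upd b k true).

(** A permutation of basis states acts on amplitudes by precomposition with its inverse; on distinct
    wires CNOT is an involution. *)
Definition cnot (a t : nat) (v : state) : state :=
  fun b => v (upd b t (b a (+) b t)).

Definition ob (c : bool) : 'I_2 := inord c.

Definition gate_op (m : nat) (g : gate m) : state -> state :=
  match g with
  | Single k U => single k (fun c d => U (ob c) (ob d))
  | CNOT a t => cnot a t
  end.

Definition circuit_op (m : nat) (gs : seq (gate m)) (v : state) : state :=
  foldr (@gate_op m) v gs.

Definition bord (m : nat) (b : bits) : 'I_(2 ^ m) := Ordinal (bval_lt m b).

Lemma bord_bitn m (z : 'I_(2 ^ m)) : bord m (bitn^~ z) = z.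
Proof. by apply/val_inj; rewrite /= bval_bitn modn_small. Qed.

Lemma bval_upd_in m b k c : (k < m)%N ->
  bval m (upd b k c) = (bval m (upd b k false) + c * 2 ^ k)%N.
Proof.
elim: m => [//|m IH] /=; rewrite ltnS leq_eqVlt => /orP[/eqP->|km].
  by rewrite !bval_upd // /upd eqxx; lia.
by rewrite IH // {2 4}/upd; case: eqP; lia.
Qed.

Lemma upd_id (b : bits) k c : b k = c -> upd b k c = b.
Proof. by move=> <-; apply/funext => i; rewrite /upd; case: eqP => // ->. Qed.

Lemma updK b k c d : upd (upd b k c) k d = upd b k d.
Proof. by apply/funext => i; rewrite /upd; case: eqP. Qed.

Lemma upd_same b k c : upd b k c k = c.
Proof. by rewrite /upd eqxx. Qed.

Lemma upd_neq b k c i : i != k -> upd b k c i = b i.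
Proof. by rewrite /upd => /negbTE->. Qed.

Lemma clrbit_bval m b k : (k < m)%N ->
  clrbit k (bval m b) = bval m (upd b k false).
Proof.
move=> km; rewrite /clrbit bitn_bval //.
by rewrite -{1}(upd_id (erefl (b k))) bval_upd_in // addnK.
Qed.

Lemma flipbit_bval m b k : (k < m)%N ->
  flipbit k (bval m b) = bval m (upd b k (~~ b k)).
Proof.
move=> km; rewrite /flipbit bitn_bval // -{2 3}(upd_id (erefl (b k))).
rewrite (bval_upd_in _ (~~ _)) // (bval_upd_in _ (b k)) //.
by case: (b k); lia.
Qed.

Lemma cnot_bval m b a t : (a < m)%N -> (t < m)%N ->
  (if bitn a (bval m b) then flipbit t (bval m b) else bval m b) =
  bval m (upd b t (b a (+) b t)).
Proof.
move=> am tm; rewrite bitn_bval // flipbit_bval //.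
by case: (b a) => //=; rewrite upd_id.
Qed.

Lemma gate_mx_op m (g : gate m) (M : 'M[Cx]_(2 ^ m)) y : gate_ok g ->
  gate_op g (fun b => M (bord m b) y) =
  fun b => (gate_mx g *m M) (bord m b) y.
Proof.
move=> okg; apply/funext => b; rewrite mxE; case: g okg => [k U _|a t at_] /=.
  (* Row [b] of a single-qubit gate is supported on the two columns that agree with [b] off wire
     [k]. *)
  have neq : bord m (upd b k true) != bord m (upd b k false).
    apply/eqP => /(congr1 val) /= /bval_inj /(_ k (ltn_ord k)).
    by rewrite !upd_same.
  rewrite (bigD1 (bord m (upd b k false))) //= (bigD1 (bord m (upd b k true))) //=.
  rewrite big1 ?addr0 => [|z].
    rewrite !mxE /= !clrbit_bval // !updK eqxx /bit_ord !bitn_bval // !upd_same.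
    by [].
  rewrite -(bord_bitn z); set b' : bits := bitn^~ z => /andP[n0 n1].
  rewrite mxE /= !clrbit_bval //; case: eqP => [E|_]; last by rewrite mul0r.
  suff E' : bord m b' = bord m (upd b k (b' k)).
    by case: (b' k) E' => E'; rewrite E' eqxx in n0 n1.
  apply/val_inj/eq_bval => i im; have := bval_inj E im.
  by rewrite /upd; case: eqP => [->|].
rewrite (bigD1 (bord m (upd b t (b a (+) b t)))) //= big1 ?addr0 => [|z].
  rewrite !mxE /= cnot_bval // updK upd_same upd_neq // addbA addbb addFb.
  by rewrite upd_id // eqxx mul1r.
rewrite -(bord_bitn z); set b' : bits := bitn^~ z => n0.
rewrite mxE /= cnot_bval //; case: eqP => [E|_]; last by rewrite mul0r.
case/eqP: n0; apply/val_inj/eq_bval => i im.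
have := bval_inj E (ltn_ord a); have := bval_inj E (ltn_ord t).
have := bval_inj E im; rewrite upd_same (upd_neq _ _ at_) => Ei -> ->.
by move: Ei; rewrite /upd; case: eqP => [-> _|//]; rewrite addbA addbb.
Qed.

Lemma circuit_mx_op m (gs : seq (gate m)) x y :
  (forall g, List.In g gs -> gate_ok g) ->
  circuit_mx gs x y =
  circuit_op gs (fun b => (bval m b == y)%:R) (bitn^~ x).
Proof.
move=> ok; rewrite /circuit_mx -{1}(bord_bitn x).
suff -> : circuit_op gs (fun b => (bval m b == y)%:R) =
   fun b => (\prod_(g <- gs) gate_mx g) (bord m b) y by [].
elim: gs ok => [_|g gs IH ok] /=.
  by apply/funext => b; rewrite big_nil mxE.
rewrite IH => [|h hh]; last by apply: ok; right.
by rewrite big_cons gate_mx_op //; apply: ok; left.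
Qed.

(** * Realizable operators and their gate counts *)

Definition realizable (m : nat) (T : state -> state) (s : nat) : Prop :=
  exists gs : seq (gate m),
    [/\ (size gs <= s)%N, (forall g, List.In g gs -> gate_ok g) &
        forall v, circuit_op gs v = T v].

Lemma realizable_id m : realizable m id 0.
Proof. by exists [::]; split. Qed.

Lemma circuit_op_cat m (gs hs : seq (gate m)) v :
  circuit_op (gs ++ hs) v = circuit_op gs (circuit_op hs v).
Proof. by rewrite /circuit_op foldr_cat. Qed.

Lemma realizable_comp m T1 s1 T2 s2 : realizable m T1 s1 ->
  realizable m T2 s2 -> realizable m (T1 \o T2) (s1 + s2).
Proof.
move=> [g1 [S1 O1 E1]] [g2 [S2 O2 E2]]; exists (g1 ++ g2); split.
- by rewrite size_cat leq_add.
- by move=> g /(@List.in_app_or _ _ _ _) [/O1|/O2].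
- by move=> v; rewrite circuit_op_cat E1 E2.
Qed.

Lemma realizable_le m T s s' : realizable m T s -> (s <= s')%N ->
  realizable m T s'.
Proof. by move=> [gs [S O E]] l; exists gs; split=> //; apply: leq_trans l. Qed.

Lemma eq_realizable m T T' s : (forall v b, T v b = T' v b) ->
  realizable m T s -> realizable m T' s.
Proof.
move=> TT [gs [S O E]]; exists gs; split=> // v; rewrite E.
by apply/funext => b.
Qed.

Lemma realizable_cnot m a t : (a < m)%N -> (t < m)%N -> a != t ->
  realizable m (cnot a t) 1.
Proof.
move=> am tm at_; exists [:: CNOT (Ordinal am) (Ordinal tm)]; split=> //.
by move=> g [<-|].
Qed.

Definition unitary2 (f : bool -> bool -> Cx) : Prop :=
  forall a c, f a false * (f c false)^* + f a true * (f c true)^* = (a == c)%:R.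

Lemma big_bool_ord (F : 'I_2 -> Cx) :
  \sum_i F i = F (ob false) + F (ob true).
Proof.
rewrite big_ord_recl big_ord1; congr (F _ + F _);
by apply/val_inj; rewrite /= inordK.
Qed.

Lemma realizable_single m k f : (k < m)%N -> unitary2 f ->
  realizable m (single k f) 1.
Proof.
move=> km uf.
pose U : 'M[Cx]_2 := \matrix_(i, j) f (odd i) (odd j).
exists [:: Single (Ordinal km) U]; split=> //.
  move=> g [<-|//] /=; apply/matrixP => i j.
  rewrite !mxE big_bool_ord !mxE !inordK //= uf.
  case: i => [[|[|//]] Hi]; case: j => [[|[|//]] Hj] //=;
    by rewrite -val_eqE.
move=> v; apply/funext => b; rewrite /= /single !mxE !inordK //=.
  by case: (b k).
by case: (b k).
Qed.

Definition gate_inv m (g : gate m) : gate m :=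
  match g with Single k U => Single k (adj_mx U) | CNOT a t => CNOT a t end.

Lemma adj_mxK m (A : 'M[Cx]_m) : adj_mx (adj_mx A) = A.
Proof. by apply/matrixP => i j; rewrite !mxE conjCK. Qed.

Lemma gate_inv_ok m (g : gate m) : gate_ok g -> gate_ok (gate_inv g).
Proof.
by case: g => //= k U; rewrite /unitary_mx adj_mxK => /mulmx1C.
Qed.

Lemma gate_invK m (g : gate m) v : gate_ok g ->
  gate_op (gate_inv g) (gate_op g v) = v.
Proof.
case: g => [k U|a t] /= ok; apply/funext => b.
  move: (adj_mx U) (mulmx1C ok) => A AU.
  have E i j : A i (ob false) * U (ob false) j + A i (ob true) * U (ob true) j =
    (i == j)%:R.
    have := congr1 (fun M : 'M_2 => M i j) AU.
    by rewrite /= mxE big_bool_ord mxE.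
  rewrite /single !updK !upd_same !mulrDr !mulrA addrACA -!mulrDl !E.
  case bk: (b k); rewrite -!val_eqE /= !inordK //= mul0r mul1r ?add0r ?addr0;
    by rewrite upd_id.
by rewrite /cnot updK upd_same upd_neq // addbA addbb addFb upd_id.
Qed.

Lemma circuit_inv m (gs : seq (gate m)) :
  (forall g, List.In g gs -> gate_ok g) ->
  exists hs : seq (gate m), [/\ size hs = size gs,
    (forall g, List.In g hs -> gate_ok g) &
    forall v, circuit_op hs (circuit_op gs v) = v].
Proof.
elim: gs => [_|g gs IH ok]; first by exists [::].
have [|hs [S O E]] := IH; first by move=> h hh; apply: ok; right.
have okg : gate_ok g by apply: ok; left.
exists (hs ++ [:: gate_inv g]); split.
- by rewrite size_cat S addn1.
- by move=> h /(@List.in_app_or _ _ _ _) [/O//|[<-|//]]; apply: gate_inv_ok.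
- by move=> v; rewrite circuit_op_cat /= gate_invK.
Qed.

(** From [F X = D F], the operator [X] is [F], then [D], then the inverse circuit of [F], which has
    as many gates as that of [F]. This transfers diagonal operators through the Fourier
    transform. *)
Lemma realizable_conj m F D X s t : realizable m F s -> realizable m D t ->
  (forall v b, F (X v) b = D (F v) b) -> realizable m X (s + t + s).
Proof.
move=> rF rD FX; have [gs [S O E]] := rF; have [hs [S' O' E']] := circuit_inv O.
have rI : realizable m (circuit_op hs) s by exists hs; rewrite S'.
apply: eq_realizable (realizable_comp (realizable_comp rI rD) rF) => v b /=.
by rewrite -(funext (FX v)) -E E'.
Qed.

(** The inverse circuit is a left inverse of [T], so applying it to [T (T' v) = v] shows that it
    computes [T']. *)
Lemma realizable_inv m T T' s : realizable m T s ->
  (forall v b, T (T' v) b = v b) -> realizable m T' s.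
Proof.
move=> [gs [S O E]] TT'; have [hs [S' O' E']] := circuit_inv O.
exists hs; rewrite S'; split=> // v.
by rewrite -{1}(funext (TT' v)) -E E'.
Qed.

(** * Diagonal operators and the Fourier transform *)

Local Notation R := Rdefinitions.R.

Definition expi (t : R) : Cx := Complex (cos t) (sin t).

Lemma expiD s t : expi (s + t) = expi s * expi t.
Proof. by rewrite /expi cosD sinD; simpc; congr Complex; ring. Qed.

Lemma expi0 : expi 0 = 1.
Proof. by rewrite /expi cos0 sin0. Qed.

Lemma expi_pi : expi pi = -1.
Proof. by rewrite /expi cospi sinpi; simpc. Qed.

Lemma expi_2pin n : expi (2 * pi * n%:R) = 1.
Proof.
elim: n => [|n IH]; first by rewrite mulr0 expi0.
have -> : 2 * pi * n.+1%:R = 2 * pi * n%:R + (pi + pi) :> R.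
  by rewrite -natr1; ring.
rewrite expiD IH expiD expi_pi; ring.
Qed.

Lemma expi_pin (c : bool) : expi (pi * c%:R) = (-1) ^+ c.
Proof. by case: c; rewrite ?mulr1 ?mulr0 ?expi_pi ?expi0. Qed.

Lemma expi_conj t : (expi t)^* = expi (- t).
Proof. by rewrite /expi cosN sinN. Qed.

Lemma expi_unit t : expi t * (expi t)^* = 1.
Proof. by rewrite expi_conj -expiD subrr expi0. Qed.

Definition diag (f : bits -> R) (v : state) : state :=
  fun b => expi (f b) * v b.

Lemma realizable_diagD m f g s t : realizable m (diag f) s ->
  realizable m (diag g) t -> realizable m (diag (fun b => f b + g b)) (s + t).
Proof.
move=> rf rg; apply: eq_realizable (realizable_comp rf rg) => v b.
by rewrite /diag /= expiD mulrA.
Qed.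

Lemma eq_realizable_diag m f g s : (forall b, f b = g b) ->
  realizable m (diag f) s -> realizable m (diag g) s.
Proof. by move=> fg; apply: eq_realizable => v b; rewrite /diag fg. Qed.

Lemma realizable_phase m k t : (k < m)%N ->
  realizable m (diag (fun b => t * (b k)%:R)) 1.
Proof.
move=> km.
pose f (a c : bool) := if a == c then expi (t * a%:R) else 0.
have uf : unitary2 f.
  by case; case; rewrite /f /= ?mul0r ?add0r ?addr0 ?expi_unit // conjC0 mulr0.
apply: eq_realizable (realizable_single km uf) => v b.
rewrite /single /diag /f; case bk: (b k) => /=.
  by rewrite mul0r add0r upd_id.
by rewrite mul0r addr0 upd_id.
Qed.

(* On bits [x] and [y], [x + y - (x xor y) = 2 x y]. *)
Lemma realizable_cphase m a k t : (a < m)%N -> (k < m)%N -> a != k ->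
  realizable m (diag (fun b => t * (b a)%:R * (b k)%:R)) 5.
Proof.
move=> am km ak; have rc := realizable_cnot am km ak.
apply: eq_realizable (realizable_comp (realizable_diagD
  (realizable_phase (t / 2) am) (realizable_phase (t / 2) km))
  (realizable_comp rc (realizable_comp (realizable_phase (- (t / 2)) km) rc))).
move=> v b; rewrite /= /diag /cnot updK upd_same upd_neq // addbA addbb addFb.
rewrite upd_id // mulrA -expiD; congr (expi _ * _).
by case: (b a); case: (b k) => /=; field.
Qed.

(** The register value is linear in its bits, so the phase is a product of one phase per bit, with
    angle [t * 2 ^ k] at bit [k]. *)
Lemma realizable_diag_bval m q (cond : bits -> bool) s :
  (forall k t, (k < q)%N ->
     realizable m (diag (fun b => t * (cond b)%:R * (b k)%:R)) s) ->
  forall t, realizable m (diag (fun b => t * (cond b)%:R * (bval q b)%:R)) (q * s).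
Proof.
move=> H t; elim: q H => [_|q IH H].
  apply: eq_realizable (realizable_id m) => v b.
  by rewrite /diag /= mulr0 expi0 mul1r.
rewrite mulSn addnC.
apply: eq_realizable_diag (realizable_diagD (IH _) (H q (t * 2 ^+ q) _)) => //.
  by move=> b /=; rewrite natrD natrM natrX; ring.
by move=> k t' kq; apply: H; lia.
Qed.

Lemma realizable_phases m q t : (q <= m)%N ->
  realizable m (diag (fun b => t * true%:R * (bval q b)%:R)) q.
Proof.
move=> qm; rewrite -[q in X in realizable _ _ X]muln1.
apply: (realizable_diag_bval (cond := fun=> true)) => k t' kq.
have km := leq_trans kq qm.
by apply: eq_realizable_diag (realizable_phase t' km) => b; rewrite mulr1.
Qed.

Lemma realizable_cphases m q c t : (q <= c)%N -> (c < m)%N ->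
  realizable m (diag (fun b => t * (b c)%:R * (bval q b)%:R)) (q * 5).
Proof.
move=> qc cm; apply: (realizable_diag_bval (cond := fun b => b c)) => k t' kq.
by apply: realizable_cphase; lia.
Qed.

Definition isqrt2 : R := (Num.sqrt 2)^-1.

Lemma isqrt2_sq : isqrt2 * isqrt2 = 2^-1.
Proof. by rewrite /isqrt2 -invfM -expr2 sqr_sqrtr // ler0n. Qed.

Lemma isqrt2C_sq : isqrt2%:C%C * isqrt2%:C%C = 2^-1 :> Cx.
Proof. by rewrite -rmorphM isqrt2_sq fmorphV rmorphMn. Qed.

Definition hadamard (k : nat) : state -> state :=
  single k (fun a c => isqrt2%:C%C * (-1) ^+ (a && c)).

Lemma realizable_hadamard m k : (k < m)%N -> realizable m (hadamard k) 1.
Proof.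
move=> km; apply: realizable_single => // a c.
have Ec (d : bool) : (isqrt2%:C%C * (-1) ^+ d : Cx)^* = isqrt2%:C%C * (-1) ^+ d.
  have -> : isqrt2%:C%C * (-1) ^+ d = (isqrt2 * (-1) ^+ d)%:C%C :> Cx.
    by rewrite rmorphM rmorphXn rmorphN1.
  exact: conjc_real.
have EE x y : isqrt2%:C%C * x * (isqrt2%:C%C * y) = 2^-1 * (x * y) :> Cx.
  by rewrite mulrACA isqrt2C_sq.
rewrite !Ec !EE.
by case: a; case: c; rewrite /= ?expr1 ?expr0; field.
Qed.

(** * Permutations of the wires *)

Definition swap (i j : nat) (v : state) : state :=
  fun b => v (upd (upd b i (b j)) j (b i)).

Lemma realizable_swap m i j : (i < m)%N -> (j < m)%N -> i != j ->
  realizable m (swap i j) 3.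
Proof.
move=> im jm ij; have ji : j != i by rewrite eq_sym.
have r1 := realizable_cnot im jm ij; have r2 := realizable_cnot jm im ji.
apply: eq_realizable (realizable_comp r1 (realizable_comp r2 r1)) => v b.
rewrite /= /cnot /swap; congr v; apply/funext => k; rewrite /upd.
rewrite !eqxx (negbTE ij) (negbTE ji).
by case: (k == j); case: (k == i); case: (b i); case: (b j).
Qed.

Definition rotb (q : nat) (b : bits) : bits :=
  fun i => if (i < q)%N then b i.+1 else if i == q then b 0%N else b i.

(** The rotation is a product of [q] adjacent transpositions: [rotb q.+1 b] is [rotb q b] with
    positions [q] and [q.+1] exchanged. *)
Lemma realizable_rotb m q : (q < m)%N ->
  realizable m (fun v b => v (rotb q b)) (q * 3).
Proof.
elim: q => [_|q IH qm].
  apply: eq_realizable (realizable_id m) => v b; congr v.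
  by apply/funext => i; rewrite /rotb ltn0; case: eqP => // ->.
rewrite mulSn addnC; have nq : q != q.+1 by lia.
have := realizable_comp (IH (ltnW qm)) (realizable_swap (ltnW qm) qm nq).
apply: eq_realizable => v b /=; rewrite /swap; congr v; apply/funext => i.
have Eq : rotb q b q = b 0%N by rewrite /rotb ltnn eqxx.
have ESq : rotb q b q.+1 = b q.+1.
  by rewrite /rotb ltnNge leqnSn /= eq_sym (negbTE nq).
rewrite Eq ESq /upd /rotb ltnS.
by case: (ltngtP i q) => [lt|gt|->]; rewrite ?(negbTE nq) //; case: eqP => //; lia.
Qed.

Lemma bval_succ q b : bval q.+1 b = (b 0%N + 2 * bval q (b \o succn))%N.
Proof.
elim: q => [|q IH]; first by rewrite /= muln0 !addn0 muln1.
by rewrite [LHS]/= -/(bval q.+1 b) IH /= expnS; lia.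
Qed.

Lemma bval_rotb q b : bval q.+1 b = (b 0%N + 2 * bval q (rotb q b))%N.
Proof.
rewrite bval_succ; congr (_ + 2 * _)%N.
by apply: eq_bval => i iq; rewrite /rotb iq.
Qed.

Lemma setlow_eq q x b c : (forall i, (q <= i)%N -> b i = c i) ->
  x = bval q c %[mod 2 ^ q] -> setlow q x b = c.
Proof.
move=> bc xc; rewrite -setlow_mod xc setlow_mod -[RHS](setlow_bval q c).
by apply/funext => i; rewrite /setlow; case: ltnP => // /bc.
Qed.

(** All positions up to [q] are overwritten, so agreement above [q] is enough; this admits
    [b' = rotb q b] in the Fourier recursion. *)
Lemma setlow_succ q x b b' (c : bool) : (x < 2 ^ q)%N ->
  (forall i, (q < i)%N -> b i = b' i) ->
  setlow q.+1 (x + c * 2 ^ q) b = upd (setlow q x b') q c.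
Proof.
move=> xq bb'; apply: setlow_eq => [i qi|].
  rewrite /upd /setlow; case: eqP => [E|_]; first lia.
  by rewrite ltnNge (ltnW qi) /= bb'.
by rewrite /= upd_same bval_upd // bval_setlow (modn_small xq).
Qed.

(** The sign in the exponent is positive, the low bits of [b] are the output frequency, and the
    prefactor is [2 ^ (- q / 2)]. *)
Definition qft (q : nat) (v : state) : state :=
  fun b => isqrt2%:C%C ^+ q *
    \sum_(x < 2 ^ q) expi (2 * pi * (bval q b * x)%:R / 2 ^+ q) * v (setlow q x b).

Lemma sum_double (F : nat -> Cx) N :
  \sum_(x < N + N) F x = \sum_(x < N) F x + \sum_(x < N) F (N + x)%N.
Proof. exact: big_split_ord. Qed.

(* Decimation in frequency: the top input bit becomes the lowest output bit,
   and the cyclic rotation of the wires puts it in place. *)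
Lemma qft_succ q v b :
  qft q.+1 v b =
  qft q (diag (fun b => 2 * pi / 2 ^+ q.+1 * (b q)%:R * (bval q b)%:R)
    (hadamard q v)) (rotb q b).
Proof.
rewrite /qft /diag /hadamard /single.
pose F (x : nat) :=
  expi (2 * pi * (bval q.+1 b * x)%:R / 2 ^+ q.+1) * v (setlow q.+1 x b).
rewrite -[\sum_(x < 2 ^ q.+1) _]/(\sum_(x < 2 ^ q.+1) F x).
rewrite -two_pow_double sum_double -big_split /= /F.
rewrite exprSr -mulrA; congr (_ * _); rewrite big_distrr /=.
apply: eq_bigr => x _.
have xq := ltn_ord x.
have agree i : (q < i)%N -> b i = rotb q b i.
  by move=> qi; rewrite /rotb ltnNge (ltnW qi) /= gtn_eqF.
have H0 : setlow q.+1 x b = upd (setlow q x (rotb q b)) q false.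
  by rewrite -(setlow_succ false xq agree) addn0.
have H1 : setlow q.+1 (2 ^ q + x) b = upd (setlow q x (rotb q b)) q true.
  by rewrite -(setlow_succ true xq agree) mul1n addnC.
rewrite H0 H1 bval_setlow (modn_small xq).
have -> : setlow q x (rotb q b) q = b 0%N by rewrite /setlow /rotb ltnn eqxx.
rewrite -/(bval q.+1 b) bval_rotb; set j := bval q _; set c := b 0%N.
rewrite andbF andbT expr0 -expi_pin.
have n0 : 2 ^+ q != 0 :> R by rewrite expf_neq0 // pnatr_eq0.
(* The top input bit contributes [pi * c], which is the Hadamard sign, and [2 * pi * j], which is a
   whole number of turns. *)
have -> : 2 * pi * ((c + 2 * j) * (2 ^ q + x))%:R / 2 ^+ q.+1 =
   2 * pi * (j * x)%:R / 2 ^+ q + 2 * pi / 2 ^+ q.+1 * c%:R * x%:R + pi * c%:R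
   + 2 * pi * j%:R :> R.
  by rewrite !(natrD, natrM, natrX) exprS; field.
have -> : 2 * pi * ((c + 2 * j) * x)%:R / 2 ^+ q.+1 =
   2 * pi * (j * x)%:R / 2 ^+ q + 2 * pi / 2 ^+ q.+1 * c%:R * x%:R :> R.
  by rewrite !(natrD, natrM) exprS; field.
rewrite !expiD expi_2pin; ring.
Qed.

(** Passing from [q] to [q.+1] adds [3 q] gates for the rotation, [5 q] for the controlled phases
    and one Hadamard gate, below the increment [16 q + 8] of the bound. *)
Lemma realizable_qft m q : (q <= m)%N -> realizable m (qft q) (8 * q ^ 2).
Proof.
elim: q => [_|q IH qm].
  apply: eq_realizable (realizable_id m) => v b.
  rewrite /qft expr0 mul1r big_ord1 /= mulr0 mul0r expi0 mul1r; congr v.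
have r := realizable_comp (realizable_rotb qm) (realizable_comp (IH (ltnW qm))
  (realizable_comp (realizable_cphases (2 * pi / 2 ^+ q.+1) (leqnn q) qm)
     (realizable_hadamard qm))).
apply: realizable_le (eq_realizable _ r) _ => [v b|]; last by lia.
by rewrite qft_succ.
Qed.

(** * Modular shifts *)

(** The amplitude at [x] is read off at [x + 1], so basis states move down by one; [unshift] reads
    at [x - 1], written as [x + (2 ^ q - 1)] to stay in the naturals. *)
Definition shift (cond : bits -> bool) (q : nat) (v : state) : state :=
  fun b => v (if cond b then setlow q (bval q b).+1 b else b).

Definition unshift (cond : bits -> bool) (q : nat) (v : state) : state :=
  fun b => v (if cond b then setlow q (bval q b + (2 ^ q).-1) b else b).

Lemma sum_cyclic (G : nat -> Cx) N : G N = G 0%N ->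
  \sum_(x < N) G x.+1 = \sum_(x < N) G x.
Proof.
move=> GN; apply: (@addrI _ (G 0%N)); rewrite -{2}GN [RHS]addrC.
by rewrite -(big_ord_recr N (fun x : 'I__ => G x)) big_ord_recl.
Qed.

(** Replacing [x] by [x + 1] in the Fourier sum costs a phase linear in the frequency. The control
    ignores the low bits, hence is constant along the sum. *)
Lemma qft_shift cond q v b : (forall x b, cond (setlow q x b) = cond b) ->
  qft q (shift cond q v) b =
  diag (fun b => - (2 * pi / 2 ^+ q) * (cond b)%:R * (bval q b)%:R) (qft q v) b.
Proof.
move=> hc; rewrite /qft /diag mulrCA; congr (_ * _).
rewrite /shift; case cb: (cond b); last first.
  rewrite mulr0 mul0r expi0 mul1r; apply: eq_bigr => x _.
  by rewrite hc cb.
set j := bval q b.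
pose G x := expi (2 * pi * (j * x)%:R / 2 ^+ q) * v (setlow q x b).
have n0 : 2 ^+ q != 0 :> R by rewrite expf_neq0 // pnatr_eq0.
(* Cyclic reindexing needs the summand to agree at [2 ^ q] and [0]: the exponentials differ by [j]
   full turns and [setlow] reduces modulo [2 ^ q]. *)
rewrite -(@sum_cyclic G) /G => [|]; last first.
  congr (_ * v _); last by rewrite -setlow_mod modnn.
  rewrite muln0 mulr0 mul0r expi0 natrM natrX.
  by rewrite -[RHS](expi_2pin j); congr expi; field.
rewrite big_distrr /=; apply: eq_bigr => x _.
rewrite hc cb bval_setlow setlowK modn_small // mulrA -expiD; congr (expi _ * _).
by rewrite !natrM -natr1; field.
Qed.

(** Two Fourier circuits of at most [8 * q ^ 2] gates surround [q * s] phase gates, and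
    [16 * q ^ 2 + 5 * q] is at most [21 * q ^ 2]. The opposite shift is the inverse circuit. *)
Lemma realizable_shift_gen m q (cond : bits -> bool) s : (q <= m)%N -> (s <= 5)%N ->
  (forall x b, cond (setlow q x b) = cond b) ->
  (forall t,
    realizable m (diag (fun b => t * (cond b)%:R * (bval q b)%:R)) (q * s)) ->
  realizable m (shift cond q) (21 * q ^ 2) /\
  realizable m (unshift cond q) (21 * q ^ 2).
Proof.
move=> qm s5 hc hd.
have rs : realizable m (shift cond q) (21 * q ^ 2).
  apply: realizable_le (realizable_conj (realizable_qft qm) (hd _) _) _.
    by move=> v b; exact: qft_shift.
  by case: q {qm hc hd} => [|q]; nia.
split=> //; apply: realizable_inv rs _ => v b.
rewrite /unshift /shift; case cb: (cond b); last by rewrite cb.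
rewrite hc cb setlowK bval_setlow; congr v; apply: setlow_eq => //.
rewrite modnDml addSnnS prednK ?expn_gt0 //.
by rewrite modnDr.
Qed.

Lemma realizable_shift m q : (q <= m)%N ->
  realizable m (shift (fun=> true) q) (21 * q ^ 2) /\
  realizable m (unshift (fun=> true) q) (21 * q ^ 2).
Proof.
move=> qm; apply: (realizable_shift_gen (s := 1)) => // t.
by rewrite muln1; exact: realizable_phases.
Qed.

Lemma realizable_cshift m q c : (q <= c)%N -> (c < m)%N ->
  realizable m (shift (fun b => b c) q) (21 * q ^ 2).
Proof.
move=> qc cm; apply: (proj1 (realizable_shift_gen (s := 5) _ _ _ _)) => //.
- lia.
- by move=> x b; rewrite /setlow ltnNge qc.
- by move=> t; exact: realizable_cphases.
Qed.

Definition zflip (n : nat) (v : state) : state :=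
  fun b => v (if bval n b == 0%N then upd b n (~~ b n) else b).

(* Decrementing [n] bits and then incrementing [n + 1] bits changes only the
   carry. *)
Lemma realizable_zflip m n : (n < m)%N ->
  realizable m (zflip n) (105 * n.+1 ^ 2).
Proof.
move=> nm; have [_ r1] := realizable_shift (ltnW nm).
have [r2 _] := realizable_shift nm.
apply: realizable_le (eq_realizable _ (realizable_comp r1 r2)) _; last by nia.
move=> v b; rewrite /= /unshift /shift /zflip; congr v.
have p0 : (0 < 2 ^ n)%N by rewrite expn_gt0.
have bl := bval_lt n b.
set b1 := setlow n _ b.
have b1n : b1 n = b n by rewrite /b1 /setlow ltnn.
have b1v : bval n b1 = ((bval n b + (2 ^ n).-1) %% 2 ^ n)%N by rewrite bval_setlow.
have agree i : (n < i)%N -> b1 i = b i.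
  by move=> ni; rewrite /b1 /setlow ltnNge (ltnW ni).
apply: setlow_eq => [i ni|].
  by rewrite agree //; case: eqP => // _; rewrite upd_neq // gtn_eqF.
rewrite /= b1n b1v expnS.
(* If the low bits vanish, decrementing makes them all ones and the increment carries into bit
   [n]. *)
case: eqP => [bz|bz].
  rewrite upd_same bval_upd // bz add0n (@modn_small _.-1) ?prednK //.
  case: (b n) => /=; rewrite -addSn prednK // ?mul1n ?mul0n ?addn0 //.
  by rewrite addnn -mul2n modnn mod0n.
(* Otherwise the decrement does not wrap around and the increment undoes it. *)
congr (_ %% _)%N.
have -> : (bval n b + (2 ^ n).-1 = (bval n b).-1 + 2 ^ n)%N by lia.
rewrite modnDr modn_small; lia.
Qed.

Definition ccomplb (c q : nat) (b : bits) : bits :=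
  fun i => if (i < q)%N then b c (+) b i else b i.

Lemma realizable_ccompl m c q : (q <= c)%N -> (c < m)%N ->
  realizable m (fun v b => v (ccomplb c q b)) q.
Proof.
move=> + cm; elim: q => [_|q IH qc].
  apply: eq_realizable (realizable_id m) => v b; congr v.
have qm : (q < m)%N by lia.
have cq : c != q by lia.
rewrite -addn1.
apply: eq_realizable (realizable_comp (IH (ltnW qc)) (realizable_cnot cm qm cq)).
move=> v b; rewrite /= /cnot; congr v; apply/funext => i.
have cltq : (c < q)%N = false by lia.
rewrite /upd /ccomplb addn1 ltnS cltq ltnn.
by case: (ltngtP i q) => // ->.
Qed.

Lemma bval_compl q b : (bval q (fun i => ~~ b i) + bval q b = (2 ^ q).-1)%N.
Proof.
elim: q => [//|q IH] /=; rewrite expnS; have := expn_gt0 2 q.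
by case: (b q) => /=; lia.
Qed.

(** * The cosine and sine transforms *)

Local Notation theta N j l := (j%:R * (l%:R + 2^-1) * pi / N%:R : R).

Definition trig_entry (n : nat) (d : bool) (l j : nat) : Cx :=
  isqrt2%:C%C ^+ n *
    (if d then Complex 0 (sin (theta (2 ^ n) j l))
     else (cos (theta (2 ^ n) j l))%:C%C).

Definition fourier_part (n : nat) : state -> state :=
  diag (fun b => pi / 2 ^+ n.+1 * true%:R * (bval n.+1 b)%:R) \o
  (qft n.+1 \o ((fun v b => v (ccomplb n n b)) \o hadamard n)).

Lemma realizable_fourier_part m n : (n < m)%N ->
  realizable m (fourier_part n) (n.+1 + (8 * n.+1 ^ 2 + (n + 1))).
Proof.
move=> nm.
exact: (realizable_comp (realizable_phases _ nm) (realizable_comp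
  (realizable_qft nm) (realizable_comp (realizable_ccompl (leqnn n) nm)
     (realizable_hadamard nm)))).
Qed.

Lemma sum_delta (F : nat -> Cx) N l : (l < N)%N ->
  \sum_(x < N) F x * ((x : nat) == l)%:R = F l.
Proof.
move=> lN; rewrite (bigD1 (Ordinal lN)) //= eqxx mulr1 big1 ?addr0 // => x.
by rewrite -val_eqE /= => /negbTE->; rewrite mulr0.
Qed.

Lemma expi_addV t : expi t + expi (- t) = 2 * (cos t)%:C%C.
Proof.
have -> : 2 * (cos t)%:C%C = (cos t)%:C%C + (cos t)%:C%C :> Cx by ring.
by rewrite /expi cosN sinN; simpc; congr Complex; ring.
Qed.

Lemma expi_subV t : expi t - expi (- t) = 2 * Complex 0 (sin t).
Proof.
have -> : 2 * Complex 0 (sin t) = Complex 0 (sin t) + Complex 0 (sin t) :> Cx.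
  by ring.
by rewrite /expi cosN sinN; simpc; congr Complex; ring.
Qed.

(** With [N = 2 ^ n], only the terms at [l] and at its mirror image [2N - 1 - l] survive in the
    Fourier sum. The final phase moves the centre of symmetry by half a step, so they become
    [expi t] and [expi (- t)], whose sum or difference is a cosine or a sine. *)
Lemma fourier_part_basis n (d : bool) l b : (l < 2 ^ n)%N ->
  fourier_part n (fun b => (bval n.+1 b == (l + d * 2 ^ n)%N)%:R) b =
  trig_entry n d l (bval n.+1 b).
Proof.
move=> lN; set j := bval n.+1 b; set v := (fun b => _ : Cx).
set w : state := (fun b => hadamard n v (ccomplb n n b)).
have vE c e : v (upd c n e) = ((bval n c + e * 2 ^ n)%N == (l + d * 2 ^ n)%N)%:R.
  by rewrite /v /= upd_same bval_upd.
(* The state [w] entering the Fourier transform has one peak at [l] in the lower half and, by [w1]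
   below, one at the complement of [l] in the upper half, with sign [(-1) ^+ d]. *)
have w0 x : (x < 2 ^ n)%N ->
    w (setlow n.+1 x b) = isqrt2%:C%C * (x == l)%:R.
  move=> xN; have := setlow_succ false xN (fun i _ => erefl (b i)).
  rewrite addn0 => ->; rewrite /w.
  set c := upd _ _ _; have cn : c n = false by rewrite /c upd_same.
  have -> : ccomplb n n c = c.
    by apply/funext => i; rewrite /ccomplb cn; case: ltnP.
  rewrite /hadamard /single cn /= !vE expr0 !mulr1 -mulrDr; congr (_ * _).
  rewrite /c bval_upd // bval_setlow modn_small // -natrD; congr (_%:R).
  by case: (d); do 3![case: eqP] => //=; lia.
have w1 x : (x < 2 ^ n)%N ->
    w (setlow n.+1 (2 ^ n + x) b) =
    isqrt2%:C%C * (-1) ^+ d * (x == (2 ^ n).-1 - l)%N%:R.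
  move=> xN; have := setlow_succ true xN (fun i _ => erefl (b i)).
  rewrite mul1n addnC => ->; rewrite /w.
  set c := upd _ _ _; have cn : c n = true by rewrite /c upd_same.
  have c'n : ccomplb n n c n = true by rewrite /ccomplb ltnn.
  have c'v : bval n (ccomplb n n c) = ((2 ^ n).-1 - x)%N.
    have cv : bval n c = x by rewrite bval_upd // bval_setlow modn_small.
    rewrite -(bval_compl n c) cv addnK.
    by apply: eq_bval => i i_n; rewrite /ccomplb i_n cn.
  rewrite /hadamard /single c'n /= !vE c'v expr0 expr1 -!mulrA -mulrDr.
  congr (_ * _); case: (d) => /=; do 3![case: eqP => ?];
    by [lia | rewrite ?expr1 ?expr0 /=; ring].
rewrite /fourier_part /= /diag -/w /qft -/j.
pose F (x : nat) := expi (2 * pi * (j * x)%:R / 2 ^+ n.+1) * w (setlow n.+1 x b).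
rewrite -[\sum_(x < 2 ^ n.+1) _]/(\sum_(x < 2 ^ n.+1) F x).
rewrite -two_pow_double sum_double /F.
pose E (x : nat) := isqrt2%:C%C * expi (2 * pi * (j * x)%:R / 2 ^+ n.+1).
under eq_bigr => x _ do rewrite w0 // mulrA [_ * isqrt2%:C%C]mulrC -/(E x).
under [X in _ + X]eq_bigr => x _ do
  rewrite w1 // !mulrA [_ * isqrt2%:C%C]mulrC -/(E _).
rewrite (sum_delta E lN).
rewrite (@sum_delta (fun x => E (2 ^ n + x)%N * (-1) ^+ d)); last by lia.
rewrite /E /trig_entry.
have n0 : 2 ^+ n != 0 :> R by rewrite expf_neq0 // pnatr_eq0.
set t := theta _ _ _.
(* The total angles of the two terms are [t] and, up to [j] full turns, [- t]. *)
have e1 : pi / 2 ^+ n.+1 * true%:R * j%:R + 2 * pi * (j * l)%:R / 2 ^+ n.+1 = t.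
  by rewrite /t mulr1 !(natrM, natrX) exprS; field.
have e2 : pi / 2 ^+ n.+1 * true%:R * j%:R +
    2 * pi * (j * (2 ^ n + ((2 ^ n).-1 - l)))%:R / 2 ^+ n.+1 =
    2 * pi * j%:R + (- t).
  have -> : (2 ^ n + ((2 ^ n).-1 - l) = 2 ^ n.+1 - l.+1)%N by rewrite expnS; lia.
  rewrite natrM natrB ?expnS; last lia.
  by rewrite /t mulr1 !(natrM, natrX) -natr1 exprS; field.
have h2 := isqrt2C_sq.
have f1 := congr1 expi e1; have f2 := congr1 expi e2.
rewrite expiD in f1; rewrite !expiD expi_2pin mul1r in f2.
set a := expi (pi / _ * _ * _) in f1 f2 *.
set x1 := expi (2 * pi * (j * l)%:R / _) in f1 *.
set x2 := expi (2 * pi * (j * (_ + _))%:R / _) in f2 *.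
set h := isqrt2%:C%C in h2 *.
have -> : a * (h ^+ n.+1 * (h * x1 + h * x2 * (-1) ^+ d)) =
   h ^+ n * (h * h * (a * x1 + a * x2 * (-1) ^+ d)) by rewrite exprS; ring.
congr (_ * _); rewrite f1 f2 h2; case: (d).
  by rewrite expr1 mulrN1 expi_subV; field.
by rewrite expr0 mulr1 expi_addV; field.
Qed.

(** * Pairing and mixing the rows [j] and [2N - j] *)

Definition cneg (n : nat) (v : state) : state :=
  fun b => v (if b n then setlow n (2 ^ n - bval n b) b else b).

(** Two's complement: negation modulo [2 ^ n] is bitwise complement followed by an increment, both
    controlled by bit [n]. *)
Lemma realizable_cneg m n : (n < m)%N ->
  realizable m (cneg n) (n + 21 * n ^ 2).
Proof.
move=> nm; apply: eq_realizable (realizable_comp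
  (realizable_ccompl (leqnn n) nm) (realizable_cshift (leqnn n) nm)) => v b.
rewrite /= /shift /cneg; congr v.
have -> : ccomplb n n b n = b n by rewrite /ccomplb ltnn.
case bn: (b n); last first.
  by apply/funext => i; rewrite /ccomplb bn; case: ltnP.
have -> : bval n (ccomplb n n b) = ((2 ^ n).-1 - bval n b)%N.
  rewrite -(bval_compl n b) addnK.
  by apply: eq_bval => i i_n; rewrite /ccomplb i_n bn.
have bl := bval_lt n b.
rewrite -subSn; last lia.
rewrite prednK; last lia.
by apply/funext => i; rewrite /setlow /ccomplb; case: ltnP.
Qed.

Lemma cneg_bval n (G : nat -> Cx) b :
  cneg n (fun b => G (bval n.+1 b)) b =
  G (if b n then (2 ^ n + (2 ^ n - bval n b) %% 2 ^ n)%N else bval n b).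
Proof.
rewrite /cneg; congr G; case bn: (b n) => /=; last by rewrite bn addn0.
by rewrite bval_setlow /setlow ltnn bn mul1n addnC.
Qed.

(** After pairing, the difference of the two rows keeps only cosines and the sum only sines; the
    minus sign yields the factor [-i]. Rows [0] and [N] have no partner and stay unmixed, which
    accounts for the weights [1 / sqrt 2] in [kC] and [kS]. *)
Definition zmix (n : nat) (v : state) : state :=
  fun b =>
    if bval n b == 0%N then (if b n then - v b else v b)
    else if b n then - (isqrt2%:C%C * (v (upd b n false) + v (upd b n true)))
    else isqrt2%:C%C * (v (upd b n false) - v (upd b n true)).

Lemma cos_pi4 : cos (pi / 4) = isqrt2 :> R.
Proof.
have cs : cos (pi / 4) = sin (pi / 4) :> R.
  by rewrite -[RHS]cosBpihalf -[RHS]cosN; congr cos; field.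
have c0 : 0 <= cos (pi / 4) :> R.
  by apply: cos_ge0_pihalf; have := pi_ge0 R; lra.
apply: (@pexpIrn _ 2) => //; rewrite ?nnegrE ?invr_ge0 ?sqrtr_ge0 //.
rewrite [RHS]expr2 isqrt2_sq; have := cos2Dsin2 (pi / 4 : R).
by rewrite -cs; lra.
Qed.

Lemma sin_pi4 : sin (pi / 4) = isqrt2 :> R.
Proof.
by rewrite -cosBpihalf -cosN -cos_pi4; congr cos; field.
Qed.

Lemma realizable_real_single m k (f : bool -> bool -> R) : (k < m)%N ->
  (forall a c, f a false * f c false + f a true * f c true = (a == c)%:R) ->
  realizable m (single k (fun a c => (f a c)%:C%C)) 1.
Proof.
move=> km uf; apply: realizable_single => // a c.
have E z : (z%:C%C : Cx)^* = z%:C%C by exact: conjc_real.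
by rewrite !E -!rmorphM -rmorphD uf rmorph_nat.
Qed.

(* With [A] the reflection and [B] the rotation of angle [pi / 8], [A B] is the
   off-zero block and [A X B X] is [diag(1, -1)]. *)
Lemma realizable_zmix m n : (n < m)%N ->
  realizable m (zmix n) (212 * n.+1 ^ 2).
Proof.
move=> nm; have rz := realizable_zflip nm.
pose c : R := cos (pi / 8); pose s : R := sin (pi / 8).
have one : c * c + s * s = 1 by have := cos2Dsin2 (pi / 8 : R); rewrite !expr2.
(* The entries of [A B] are double-angle expressions, so the angle [pi / 8] makes them all equal to
   [isqrt2] up to sign. *)
have p8 : pi / 4 = pi / 8 + pi / 8 :> R by field.
have dc : c * c - s * s = isqrt2 by rewrite -cos_pi4 p8 cosD.
have ds : s * c + c * s = isqrt2 by rewrite -sin_pi4 p8 sinD.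
pose A (x y : bool) : R :=
  if x then (if y then - c else - s) else (if y then - s else c).
pose B (x y : bool) : R :=
  if x then (if y then c else s) else (if y then - s else c).
have rA := @realizable_real_single m n A nm.
have rB := @realizable_real_single m n B nm.
have r : realizable m _ _ := realizable_comp (rA _) (realizable_comp rz
  (realizable_comp (rB _) rz)).
apply: realizable_le (eq_realizable _ (r _ _)) _; first last.
- by nia.
- by case; case; rewrite /A /=; lra.
- by case; case; rewrite /B /=; lra.
move=> v b /=; rewrite /zmix.
have E e : bval n (upd b n e) = bval n b by rewrite bval_upd.
rewrite -[v b in RHS](congr1 v (upd_id (erefl (b n)))).
rewrite /single /zflip !E.
set x := v (upd b n false); set y := v (upd b n true).
have one' : c%:C%C * c%:C%C + s%:C%C * s%:C%C = 1 :> Cx.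
  by rewrite -!rmorphM -rmorphD one.
have dc' : c%:C%C * c%:C%C - s%:C%C * s%:C%C = isqrt2%:C%C :> Cx.
  by rewrite -!rmorphM -rmorphB dc.
have ds' : s%:C%C * c%:C%C + c%:C%C * s%:C%C = isqrt2%:C%C :> Cx.
  by rewrite -!rmorphM -rmorphD ds.
case: eqP => bz; rewrite ?updK ?upd_same ?E.
  rewrite bz /=; case: (b n); rewrite /A /B !rmorphN -/x -/y.
    by rewrite -[y in RHS]mul1r -one'; ring.
  by rewrite -[RHS]mul1r -one'; ring.
move/eqP/negbTE: bz => -> /=.
case: (b n); rewrite /A /B !rmorphN -/x -/y.
  by rewrite [isqrt2%:C%C * _]mulrDr -{1}ds' -dc'; ring.
by rewrite [isqrt2%:C%C * _]mulrBr -{1}dc' -ds'; ring.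
Qed.

Lemma zmix_bval n (G : nat -> Cx) b :
  zmix n (cneg n (fun b => G (bval n.+1 b))) b =
  let r := bval n b in
  if r == 0%N then (if b n then - G (2 ^ n)%N else G 0%N)
  else if b n then - (isqrt2%:C%C * (G r + G (2 ^ n + (2 ^ n - r))%N))
  else isqrt2%:C%C * (G r - G (2 ^ n + (2 ^ n - r))%N).
Proof.
rewrite /zmix !cneg_bval !upd_same !bval_upd //=.
case: eqP => [->|r0].
  by case: (b n); rewrite // subn0 modnn addn0.
by rewrite modn_small //; have := bval_lt n b; lia.
Qed.

(** The half-integer [l + 1/2] makes the reflected angle [2 pi l + (pi - t)]; comparing real and
    imaginary parts of [expi] gives both identities. *)
Lemma theta_reflect n l j : (j <= 2 ^ n)%N ->
  cos (theta (2 ^ n) (2 ^ n + (2 ^ n - j))%N l) = - cos (theta (2 ^ n) j l) /\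
  sin (theta (2 ^ n) (2 ^ n + (2 ^ n - j))%N l) = sin (theta (2 ^ n) j l).
Proof.
move=> jN; set t := theta _ j _; set t' := theta _ _ _.
have n0 : 2 ^+ n != 0 :> R by rewrite expf_neq0 // pnatr_eq0.
have : t' = 2 * pi * l%:R + (pi - t).
  by rewrite /t' /t natrD natrB // natrX; field.
move/(congr1 expi); rewrite 2!expiD expi_2pin expi_pi mul1r mulN1r /expi cosN sinN.
by simpc => -[-> ->].
Qed.

Lemma trig_entry_reflect n d l j : (j <= 2 ^ n)%N ->
  trig_entry n d l (2 ^ n + (2 ^ n - j))%N =
  (if d then 1 else -1) * trig_entry n d l j.
Proof.
move=> jN; rewrite /trig_entry; have [-> ->] := theta_reflect l jN.
by case: d; rewrite ?mul1r // rmorphN; ring.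
Qed.

(** Row [N] is its own reflection, so its cosine equals its own negative. *)
Lemma trig_entry_top n l : trig_entry n false l (2 ^ n) = 0.
Proof.
have [] := theta_reflect l (leqnn (2 ^ n)); rewrite subnn addn0 => E _.
by rewrite /trig_entry (_ : cos _ = 0) ?mulr0 //; lra.
Qed.

Lemma trig_entry0 n l : trig_entry n true l 0 = 0.
Proof. by rewrite /trig_entry !mul0r sin0 mulr0. Qed.

(** This shape separates the factor [2 * isqrt2], produced by mixing two rows equal up to sign, from
    the normalization [isqrt2 ^+ n] of [trig_entry]. *)
Lemma sqrt_two_div n :
  Num.sqrt (2 / (2 ^ n)%:R) = 2 * isqrt2 * isqrt2 ^+ n :> R.
Proof.
have s0 : 0 <= isqrt2 by rewrite invr_ge0 sqrtr_ge0.
have -> : 2 / (2 ^ n)%:R = (2 * isqrt2 * isqrt2 ^+ n) ^+ 2 :> R.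
  have -> : (2 * isqrt2 * isqrt2 ^+ n) ^+ 2 =
      2 * 2 * (isqrt2 * isqrt2) * (isqrt2 * isqrt2) ^+ n.
    by rewrite [in RHS]exprMn; ring.
  by rewrite isqrt2_sq natrX exprVn mulfK ?pnatr_eq0.
by rewrite sqrtr_sqr ger0_norm // !mulr_ge0 // exprn_ge0.
Qed.

(** * The target matrix and the complete circuit *)

Definition block_entry (n : nat) (c d : bool) (r l : nat) : Cx :=
  match c, d with
  | false, false => (cII_entry (2 ^ n) r l)%:C%C
  | true, true => - 'i%C * (sII_entry (2 ^ n) r.+1 l)%:C%C
  | _, _ => 0
  end.

Lemma DCT_DST_blockE n (x y : 'I_(2 ^ n.+1)) (c d : bool) (r l : 'I_(2 ^ n)) :
  x = (r + c * 2 ^ n)%N :> nat -> y = (l + d * 2 ^ n)%N :> nat ->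
  DCT_DST_block n x y = block_entry n c d r l.
Proof.
move=> xE yE; rewrite /DCT_DST_block castmxE.
set x' := cast_ord _ x; set y' := cast_ord _ y.
have -> : x' = if c then rshift _ r else lshift _ r.
  by apply/val_inj; rewrite /= xE; case: (c) => /=; lia.
have -> : y' = if d then rshift _ l else lshift _ l.
  by apply/val_inj; rewrite /= yE; case: (d) => /=; lia.
by case: c {xE}; case: d {yE};
  rewrite ?(block_mxEul, block_mxEur, block_mxEdl, block_mxEdr) !mxE.
Qed.

Lemma trig_entry_cos n l j :
  trig_entry n false l j = (isqrt2 ^+ n * cos (theta (2 ^ n) j l))%:C%C.
Proof. by rewrite /trig_entry rmorphM rmorphXn. Qed.

Lemma trig_entry_sin n l j :
  trig_entry n true l j = 'i%C * (isqrt2 ^+ n * sin (theta (2 ^ n) j l))%:C%C.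
Proof.
rewrite /trig_entry rmorphM rmorphXn mulrCA; congr (_ * _).
by simpc.
Qed.

(** The last shift aligns the sine block, whose row [r] carries frequency [r + 1]: it reads index
    [r + 1] modulo [N], and frequency [N] sits at index [0] because [cneg] fixes zero. *)
Definition dct_dst_op (n : nat) : state -> state :=
  shift (fun b => b n) n \o (zmix n \o (cneg n \o fourier_part n)).

Lemma dct_dst_opE n (d : bool) l b : (l < 2 ^ n)%N ->
  dct_dst_op n (fun b => (bval n.+1 b == (l + d * 2 ^ n)%N)%:R) b =
  block_entry n (b n) d (bval n b) l.
Proof.
move=> lN; rewrite /dct_dst_op /= (funext (fun b => fourier_part_basis d b lN)).
have h2 : 2 * isqrt2 * isqrt2 = 1 by rewrite -mulrA isqrt2_sq divff ?pnatr_eq0.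
rewrite /shift (zmix_bval n (trig_entry n d l)); case bn: (b n) => /=; last first.
  rewrite bn; case: eqP => [->|r0].
    case: d; first by rewrite trig_entry0.
    rewrite /block_entry /cII_entry sqrt_two_div /kC eqxx -/isqrt2 trig_entry_cos.
    by congr (_%:C%C); rewrite -[X in X * _ = _]mul1r -{1}h2; ring.
  have rN := ltnW (bval_lt n b).
  rewrite trig_entry_reflect //; case: d; first by rewrite mul1r subrr mulr0.
  rewrite /block_entry /cII_entry sqrt_two_div /kC trig_entry_cos.
  by move/eqP/negbTE: r0 => ->; rewrite !rmorphM rmorph_nat rmorph1; ring.
have -> : setlow n (bval n b).+1 b n by rewrite /setlow ltnn.
rewrite bval_setlow; have bl := bval_lt n b.
case: (ltnP (bval n b).+1 (2 ^ n)) => [lt|ge].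
  rewrite modn_small //= trig_entry_reflect; last exact: ltnW.
  case: d; last by rewrite mulN1r subrr mulr0 oppr0.
  rewrite /block_entry /sII_entry sqrt_two_div /kS ltn_eqF // trig_entry_sin.
  by rewrite !rmorphM rmorph_nat rmorph1; ring.
(* The last sine row wraps to index [0], the unmixed entry, and thus receives the weight of [kS] at
   [N]. *)
have -> : (bval n b).+1 = (2 ^ n)%N by lia.
rewrite modnn /=; case: d; last by rewrite trig_entry_top oppr0.
rewrite /sII_entry sqrt_two_div /kS eqxx.
rewrite trig_entry_sin mulNr; congr (- ('i%C * _%:C%C)).
by rewrite -/isqrt2 -[X in X * _ = _]mul1r -{1}h2; ring.
Qed.

(** For positive [n], [(n + 1) ^ 2] is at most [4 * n ^ 2], and the four stages sum to at most
    [(42 + 4 * 220 + 5) * n ^ 2], within the bound. *)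
Lemma realizable_dct_dst_op m n : (n < m)%N -> (0 < n)%N ->
  realizable m (dct_dst_op n) (1000 * n ^ 2).
Proof.
move=> nm n0; apply: realizable_le (realizable_comp
  (realizable_cshift (leqnn n) nm) (realizable_comp (realizable_zmix nm)
  (realizable_comp (realizable_cneg nm) (realizable_fourier_part nm)))) _.
by nia.
Qed.

Local Close Scope ring_scope.

Theorem mainTheorem3 :
  exists (c A : nat), (0 < c)%N /\
    forall n : nat, (1 <= n)%N ->
      exists (a : nat) (gs : seq (gate (n.+1 + a))),
        [/\ (a <= A)%N,
            (size gs <= c * n ^ 2)%N,
            (forall g, List.In g gs -> gate_ok g) &
            realizes_with_ancillas gs (DCT_DST_block n)].
Proof.
exists 1000, 0; split=> // n n0.
have nm : n < n.+1 + 0 by rewrite addn0.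
have [gs [S O E]] := realizable_dct_dst_op nm n0.
exists 0, gs; split=> // y j yj; split=> [x i xi|x]; last first.
  (* Without ancillas no index reaches [2 ^ n.+1], so the condition on leakage is vacuous. *)
  by rewrite leqNgt -{2}(addn0 n.+1) ltn_ord.
have decomp (k : 'I_(2 ^ n.+1)) :
    k = bval n (bitn^~ k) + bitn n k * 2 ^ n :> nat.
  by rewrite -[LHS](modn_small (ltn_ord k)) -bval_bitn.
rewrite circuit_mx_op // E yj xi (decomp j).
have -> : bval (n.+1 + 0) = bval n.+1 by rewrite addn0.
rewrite dct_dst_opE ?bval_lt //.
apply/esym/(@DCT_DST_blockE n i j (bitn n i) (bitn n j)
  (bord n (bitn^~ i)) (bord n (bitn^~ j))); exact: decomp.
Qed.
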